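(* Let $\rho:\mathbb{R}^d\to(0,\infty)$ be a critical radius function with constants $B_0,k_0>1$, and let $1<p<\infty$. For any $c_1,c_2,c_3>0$, $0<m_1<(k_0+1)^{-1}$ and $m_2>(k_0+1)$ we have $$A_p^{\rho,\infty}\subset H_{p,c_1}^{\rho,m_1}\subset S_{p,c_2}^\rho\subset H_{p,c_3}^{\rho,m_2}.$$
   Context: Fix a dimension $d\geq3$. A weight is a locally integrable function $w$ on $\mathbb{R}^d$ that is positive almost everywhere; $w(E):=\int_Ew$; $|E|$ is Lebesgue measure; $B(x,r)$ is the open Euclidean ball. A function $\rho:\mathbb{R}^d\to(0,\infty)$ is a critical radius function with constants $k_0,B_0>1$ if $$B_0^{-1}\rho(x)\left(1+\frac{|x-y|}{\rho(x)}\right)^{-k_0}\leq\rho(y)\leq B_0\rho(x)\left(1+\frac{|x-y|}{\rho(x)}\right)^{\frac{k_0}{k_0+1}}$$ for all $x,y\in\mathbb{R}^d$. Its Agmon distance is $d_\rho(x,y):=\inf_\gamma\int_0^1\rho(\gamma(t))^{-1}|\gamma'(t)|\,dt$, the infimum over all (piecewise $C^1$) curves $\gamma:[0,1]\to\mathbb{R}^d$ connecting $x$ and $y$; $B_\rho(x,r):=\{y:d_\rho(x,y)<r\}$. $A_p^{\rho,\infty}:=\bigcup_{\theta\geq0}A_p^{\rho,\theta}$, where $A_p^{\rho,\theta}$ is the class of weights $w$ for which there is $C>0$ with $w(B)^{\frac1p}\left(\int_Bw^{-\frac1{p-1}}\right)^{\frac{p-1}p}\leq C|B|\left(1+\frac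 r{\rho(x)}\right)^\theta$ for all balls $B=B(x,r)$, $x\in\mathbb{R}^d$, $r>0$. For $c>0$, $S_{p,c}^\rho$ is the class of weights $w$ with $$\sup_{x\in\mathbb{R}^d,\,r>0}\left(\frac1{|B_\rho(x,r)|e^{cr}}\int_{B_\rho(x,r)}w\right)^{\frac1p}\left(\frac1{|B_\rho(x,r)|e^{cr}}\int_{B_\rho(x,r)}w^{-\frac1{p-1}}\right)^{\frac{p-1}p}<\infty.$$ For $m,c>0$ let $\Phi_{m,c}^\rho(x,r):=\exp\left(c\left(1+\frac r{\rho(x)}\right)^m\right)$; $H_{p,c}^{\rho,m}$ is the class of weights $w$ with $$\sup_{x\in\mathbb{R}^d,\,r>0}\left(\frac1{|B(x,r)|\Phi_{m,c}^\rho(x,r)}\int_{B(x,r)}w\right)^{\frac1p}\left(\frac1{|B(x,r)|\Phi_{m,c}^\rho(x,r)}\int_{B(x,r)}w^{-\frac1{p-1}}\right)^{\frac{p-1}p}<\infty.$$ *)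

(* Defs.v *)
From HB Require Import structures.
From mathcomp Require Import all_boot all_order all_algebra.
From mathcomp Require Import all_classical all_reals all_analysis.

Set Implicit Arguments.
Unset Strict Implicit.
Unset Printing Implicit Defensive.

Import Order.TTheory GRing.Theory Num.Theory.
Import numFieldNormedType.Exports.

Local Open Scope classical_set_scope.
Local Open Scope ring_scope.

(* Lebesgue measure on R^d is Caratheodory's restriction of the outer measure
   given by countable coverings by half-open boxes, so that the measurable
   sets are exactly the Lebesgue-measurable ones. *)
Section lebesgue_Rd.
Context {R : realType} {d : nat}.
Implicit Types (q : 'rV[R]_d * 'rV[R]_d) (A : set 'rV[R]_d).

Definition box q : set 'rV[R]_d :=
  [set x | forall i, x ord0 i \in `]q.1 ord0 i, q.2 ord0 i]].

Definition box_volume q : R :=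
  \prod_(i < d) Num.max 0 (q.2 ord0 i - q.1 ord0 i).

Definition box_cover A : set (set ('rV[R]_d * 'rV[R]_d)) :=
  [set C | countable C /\ A `<=` \bigcup_(q in C) box q].

Definition lebesgue_outer A : \bar R :=
  ereal_inf [set (\esum_(q in C) (box_volume q)%:E)%E | C in box_cover A].

Lemma box_volume_ge0 q : 0 <= box_volume q.
Proof. by apply: prodr_ge0 => i _; rewrite le_max lexx. Qed.

Lemma lebesgue_outer_ge0 A : (0 <= lebesgue_outer A)%E.
Proof.
apply: le_ereal_inf_tmp => _ [C _ <-].
by apply: esum_ge0 => q _; rewrite lee_fin box_volume_ge0.
Qed.

Lemma lebesgue_outer0 : lebesgue_outer set0 = 0%E.
Proof.
apply/eqP; rewrite eq_le lebesgue_outer_ge0 andbT.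
apply: ereal_inf_lbound; exists set0; last by rewrite esum_set0.
by split; [exact: countable0 | exact: sub0set].
Qed.

Lemma le_lebesgue_outer :
  {homo lebesgue_outer : A B / A `<=` B >-> (A <= B)%E}.
Proof.
move=> A B AB; apply: ereal_inf_le_tmp => _ [C [cC BC] <-].
by exists C => //; split => //; exact: subset_trans BC.
Qed.

Lemma lebesgue_outer_sigma_subadditive : sigma_subadditive lebesgue_outer.
Proof.
move=> F; have [[i ioo]|] := pselect (exists i, lebesgue_outer (F i) = +oo%E).
  rewrite (eseries_pinfty _ _ ioo) ?leey// => n _.
  by rewrite -ltNye (lt_le_trans _ (lebesgue_outer_ge0 _)).
rewrite -forallNE => Foo.
suff add2e (e : {posnum R}) : (lebesgue_outer (\bigcup_n F n) <=
    \sum_(i <oo) lebesgue_outer (F i) + e%:num%:E)%E.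
  by apply/lee_addgt0Pr => _/posnumP[].
rewrite (le_trans _ (epsilon_trick _ _ _))//; last first.
  by move=> n; exact: lebesgue_outer_ge0.
pose P n C := box_cover (F n) C /\ (\esum_(q in C) (box_volume q)%:E <=
  lebesgue_outer (F n) + (e%:num / (2 ^ n.+1)%:R)%:E)%E.
have [G PG] : {G : nat -> set ('rV[R]_d * 'rV[R]_d) & forall n, P n (G n)}.
  apply: (@choice _ _ P) => n.
  have en1 : (0 < e%:num / (2 ^ n.+1)%:R)%R by [].
  have Fn : lebesgue_outer (F n) \is a fin_num.
    by rewrite ge0_fin_numE ?lebesgue_outer_ge0// ltey; exact/eqP/Foo.
  have [_ [C FC <-] ltC] := lb_ereal_inf_adherent en1 Fn.
  by exists C; split => //; exact: ltW.
have vol0 q : (0 <= (box_volume q)%:E)%E by rewrite lee_fin box_volume_ge0.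
apply: (@le_trans _ _ (\esum_(q in \bigcup_n G n) (box_volume q)%:E)%E).
  apply: ereal_inf_lbound; exists (\bigcup_n G n) => //; split.
    by apply: bigcup_countable => // n _; exact: (PG n).1.1.
  move=> x [n _ Fnx]; have [q Gq xq] := (PG n).1.2 _ Fnx.
  by exists q => //; exists n.
rewrite seqDU_bigcup_eq (esum_bigcupT _ _ (@trivIset_seqDU _ G) vol0).
rewrite -nneseries_esumT; last by move=> n; exact: esum_ge0.
apply: lee_nneseries => [n _ _|n _]; first exact: esum_ge0.
apply: le_trans (PG n).2; apply: ub_ereal_sup => _ [D [fD DG] <-].
apply: ereal_sup_ubound; exists D => //; split => //.
by apply: subset_trans DG _ => q [].
Qed.

HB.instance Definition _ := isOuterMeasure.Build R 'rV[R]_d lebesgue_outer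
  lebesgue_outer0 lebesgue_outer_ge0 le_lebesgue_outer
  lebesgue_outer_sigma_subadditive.

End lebesgue_Rd.

Definition lebesgue_space (R : realType) (d : nat) : Type :=
  caratheodory_type
    (@lebesgue_outer R d : {outer_measure set 'rV[R]_d -> \bar R}).

HB.instance Definition _ (R : realType) (d : nat) :=
  Measurable.on (lebesgue_space R d).

Definition lebesgue_Rd (R : realType) (d : nat) :
    set (lebesgue_space R d) -> \bar R :=
  @lebesgue_outer R d.

HB.instance Definition _ (R : realType) (d : nat) :=
  isMeasure.Build _ (lebesgue_space R d) R (@lebesgue_Rd R d)
    (@caratheodory_measure0 _ _ (@lebesgue_outer R d))
    (@caratheodory_measure_ge0 _ _ (@lebesgue_outer R d))
    (@caratheodory_measure_sigma_additive _ _ (@lebesgue_outer R d)).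

Section euclidean.
Context {R : realType} {d : nat}.
Implicit Types (x : 'rV[R]_d) (g : R -> 'rV[R]_d).

(* The library norm on 'rV[R]_d is the sup norm. *)
Definition enorm x : R := Num.sqrt (\sum_(i < d) x ord0 i ^+ 2).

Definition eball x (r : R) : set 'rV[R]_d := [set y | enorm (y - x) < r].

Definition C1_segment (a b : R) g :=
  {within `[a, b], continuous g} /\
  exists2 g' : R -> 'rV[R]_d, {within `[a, b], continuous g'} &
    forall t, t \in `]a, b[ -> is_derive t 1 g (g' t).

Definition piecewise_C1 g := exists (n : nat) (t : nat -> R),
  [/\ t 0%N = 0, t n = 1 & forall i, (i < n)%N ->
    t i < t i.+1 /\ C1_segment (t i) (t i.+1) g].

End euclidean.

Section weights.
Context {R : realType} {d : nat}.
Implicit Types (rho w : 'rV[R]_d -> R) (x y : 'rV[R]_d) (E : set 'rV[R]_d).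

Local Notation mu := (@lebesgue_Rd R d).

Definition critical_radius (k0 B0 : R) rho :=
  [/\ 1 < k0, 1 < B0, forall x, 0 < rho x &
    forall x y,
      B0^-1 * rho x * (1 + enorm (x - y) / rho x) `^ (- k0) <= rho y /\
      rho y <= B0 * rho x * (1 + enorm (x - y) / rho x) `^ (k0 / (k0 + 1))].

(* rho is not assumed measurable. The library integral is defined for every
   nonnegative function, as the supremum of the integrals of the simple
   functions below it. *)
Definition agmon_length rho (g : R -> 'rV[R]_d) : \bar R :=
  (\int[lebesgue_measure]_(t in `[0%R, 1%R])
    ((rho (g t))^-1 * enorm (derive1 g t))%:E)%E.

Definition agmon_dist rho x y : \bar R :=
  ereal_inf [set agmon_length rho g | g in
    [set g | [/\ piecewise_C1 g, g 0 = x & g 1 = y]]].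

Definition agmon_ball rho x (r : R) : set 'rV[R]_d :=
  [set y | (agmon_dist rho x y < r%:E)%E].

Definition weight w :=
  [/\ measurable_fun [set: lebesgue_space R d] w,
      forall K : set 'rV[R]_d, compact K ->
        (\int[mu]_(x in K) `|w x|%:E < +oo)%E &
      {ae mu, forall x, 0 < w x}].

Local Open Scope ereal_scope.

Definition wint w E : \bar R := \int[mu]_(x in E) (w x)%:E.

Definition dual_wint (p : R) w E : \bar R :=
  \int[mu]_(x in E) (w x `^ (- (p - 1)^-1))%:E.

Definition Ap_theta rho (p theta : R) : set ('rV[R]_d -> R) :=
  [set w | weight w /\ exists2 C : R, (0 < C)%R &
    forall x (r : R), (0 < r)%R ->
      wint w (eball x r) `^ p^-1 * dual_wint p w (eball x r) `^ ((p - 1) / p)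
      <= C%:E * mu (eball x r) * ((1 + r / rho x) `^ theta)%:E].

Definition Ap_infty rho (p : R) : set ('rV[R]_d -> R) :=
  \bigcup_(theta in [set theta : R | (0 <= theta)%R]) Ap_theta rho p theta.

Definition weighted_mean (p : R) (N : \bar R) w E : \bar R :=
  (N^-1 * wint w E) `^ p^-1 * (N^-1 * dual_wint p w E) `^ ((p - 1) / p).

Definition S_class rho (p c : R) : set ('rV[R]_d -> R) :=
  [set w | weight w /\
    ereal_sup [set weighted_mean p
        (mu (agmon_ball rho x r) * (expR (c * r))%:E) w (agmon_ball rho x r)
      | x in [set: 'rV[R]_d] & r in [set r : R | (0 < r)%R]] < +oo].

Definition Phi rho (m c : R) x (r : R) : R :=
  expR (c * (1 + r / rho x) `^ m).

Definition H_class rho (p c m : R) : set ('rV[R]_d -> R) :=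
  [set w | weight w /\
    ereal_sup [set weighted_mean p
        (mu (eball x r) * (Phi rho m c x r)%:E) w (eball x r)
      | x in [set: 'rV[R]_d] & r in [set r : R | (0 < r)%R]] < +oo].

End weights.

(* Main.v *)
(* Write s = |x - y| / rho(x).  Integrating along the segment from x to y bounds
   d_rho(x, y) above by a multiple of s (1 + s)^k0.  Conversely, until a curve
   from x leaves B(x, s rho(x)) the weight 1/rho is at least a constant times
   ((1 + s)^(k0/(k0+1)) rho(x))^-1, so d_rho(x, y) is at least a multiple of
   s (1 + s)^(-k0/(k0+1)).  Hence B(x, a r/(1+r) rho(x)) is contained in
   B_rho(x, r), which is contained in B(x, A r (1+r)^k0 rho(x)): Agmon balls and
   Euclidean balls are nested with radii, hence volumes, comparable up to powers
   of 1 + r, respectively of 1 + s.  The hypotheses m1 < 1/(k0+1) and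
   m2 > k0+1 leave room in the exponentials to absorb these powers and all
   constants.  The weighted integrals are monotone in the set. *)
Require Import Defs.
From mathcomp Require Import all_boot all_order all_algebra.
From mathcomp Require Import all_classical all_reals all_analysis.
From mathcomp Require Import measurable_realfun.
From mathcomp Require Import ring lra.

Import Order.TTheory GRing.Theory Num.Theory.
Import numFieldNormedType.Exports.

Set Implicit Arguments.
Unset Strict Implicit.
Unset Printing Implicit Defensive.

Local Open Scope classical_set_scope.
Local Open Scope ring_scope.

(** * Powers and exponentials *)

(** Split at the threshold [u0] where [al * u ^ mu = c * u ^ nu]: below it the left side is at most
    its value at [u0], which serves as [K]; above it the term [c * u ^ nu] dominates. *)
Lemma powR_absorb (R : realType) (al c mu nu : R) : 0 <= al -> 0 < c ->
  0 <= mu -> mu < nu ->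
  exists K, forall u, 1 <= u -> al * u `^ mu <= K + c * u `^ nu.
Proof.
move=> al0 c0 mu0 munu; have e0 : 0 < nu - mu by rewrite subr_gt0.
pose u0 := (al / c) `^ (nu - mu)^-1.
have u00 : 0 <= u0 by exact: powR_ge0.
exists (al * u0 `^ mu) => u u1; have up : 0 < u by apply: lt_le_trans u1.
have [uu0|u0u] := leP u u0.
  rewrite -[leLHS]addr0 lerD ?mulr_ge0 ?powR_ge0 ?(ltW c0)//.
  by rewrite ler_wpM2l// ge0_ler_powR// nnegrE ?(ltW up).
rewrite -[leLHS]add0r lerD ?mulr_ge0 ?powR_ge0//.
have -> : u `^ nu = u `^ (nu - mu) * u `^ mu.
  by rewrite -powRD ?subrK// (gt_eqF up) implybT.
rewrite mulrA ler_wpM2r ?powR_ge0// -ler_pdivrMl// mulrC.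
have -> : al / c = u0 `^ (nu - mu).
  by rewrite -powRrM mulVf ?gt_eqF// powRr1// divr_ge0// ltW.
by apply: ge0_ler_powR; rewrite ?nnegrE// ltW.
Qed.

(** Take exponents and use [z <= 1 + z <= expR z] with [z = mu * ln u]. *)
Lemma powR_le_expR (R : realType) (a mu u : R) : 0 <= a -> 0 < mu -> 0 < u ->
  u `^ a <= expR (a / mu * u `^ mu).
Proof.
move=> a0 mu0 u0; rewrite /powR gt_eqF// ler_expR -mulrA ler_wpM2l//.
rewrite ler_pdivlMl//; apply: le_trans (expR_ge1Dx _).
by rewrite lerDr.
Qed.

(** The power [u ^ a] is first turned into an exponential of order [mu], then the gap [mu < nu]
    absorbs both. Each of the three inclusions takes its constant from here. *)
Lemma powR_expR_absorb (R : realType) (a al c mu nu : R) : 0 <= a -> 0 <= al ->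
  0 < c -> 0 < mu -> mu < nu ->
  exists2 K, 0 < K & forall u, 1 <= u ->
    u `^ a * expR (al * u `^ mu) <= K * expR (c * u `^ nu).
Proof.
move=> a0 al0 c0 mu0 munu.
have al'0 : 0 <= a / mu + al by rewrite addr_ge0// divr_ge0// ltW.
have [K HK] := powR_absorb al'0 c0 (ltW mu0) munu.
exists (expR K); first exact: expR_gt0.
move=> u u1; have u0 : 0 < u by apply: lt_le_trans u1.
rewrite -expRD; apply: (le_trans _ (_ : expR ((a / mu + al) * u `^ mu) <= _)).
  by rewrite mulrDl expRD ler_wpM2r ?expR_ge0 ?powR_le_expR.
by rewrite ler_expR HK.
Qed.

(** * The Euclidean norm *)

Lemma continuous_bigsum (R : realType) (T : topologicalType) (I : Type) (x : T)
    (s : seq I) (f : I -> T -> R) :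
  (forall i, {for x, continuous (f i)}) ->
  {for x, continuous (fun y => \sum_(i <- s) f i y)}.
Proof.
move=> fx; elim: s => [|i s IHs].
  have -> : (fun y => \sum_(i <- [::]) f i y) = cst 0.
    by apply/funext => y; rewrite big_nil.
  exact: cst_continuous.
have -> : (fun y => \sum_(j <- i :: s) f j y) =
    f i \+ (fun y => \sum_(j <- s) f j y).
  by apply/funext => y; rewrite big_cons.
by apply: continuousD; [exact: fx|exact: IHs].
Qed.

Section euclidean_norm.
Context {R : realType} {d : nat}.
Implicit Types x y v : 'rV[R]_d.

Lemma enorm_ge0 x : 0 <= enorm x. Proof. exact: sqrtr_ge0. Qed.

Lemma sqr_enorm x : enorm x ^+ 2 = \sum_(i < d) x ord0 i ^+ 2.
Proof. by rewrite sqr_sqrtr// sumr_ge0// => i _; exact: sqr_ge0. Qed.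

Lemma enormZ (a : R) x : enorm (a *: x) = `|a| * enorm x.
Proof.
rewrite /enorm -sqrtr_sqr -sqrtrM ?sqr_ge0//; congr Num.sqrt.
by rewrite mulr_sumr; apply: eq_bigr => i _; rewrite mxE exprMn.
Qed.

Lemma enormN x : enorm (- x) = enorm x.
Proof. by rewrite -scaleN1r enormZ normrN normr1 mul1r. Qed.

Lemma enormC x y : enorm (x - y) = enorm (y - x).
Proof. by rewrite -opprB enormN. Qed.

Lemma enorm0 : enorm (0 : 'rV[R]_d) = 0.
Proof. by rewrite -(scale0r 0) enormZ normr0 mul0r. Qed.

Lemma coord_le_enorm x i : `|x ord0 i| <= enorm x.
Proof.
rewrite -sqrtr_sqr ler_wsqrtr// (bigD1 i)//= lerDl.
by rewrite sumr_ge0// => j _; exact: sqr_ge0.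
Qed.

(* Cauchy-Schwarz, from the sum over [i] of
   [2 a b (x_i v_i) <= b^2 x_i^2 + a^2 v_i^2], [a = |x|], [b = |v|]. *)
Lemma dot_le_enorm x v : \sum_(i < d) x ord0 i * v ord0 i <= enorm x * enorm v.
Proof.
have [x0|x0] := eqVneq (enorm x) 0.
  rewrite x0 mul0r big1// => i _; suff -> : x ord0 i = 0 by rewrite mul0r.
  by apply/eqP; rewrite -normr_le0 -x0 coord_le_enorm.
have [v0|v0] := eqVneq (enorm v) 0.
  rewrite v0 mulr0 big1// => i _; suff -> : v ord0 i = 0 by rewrite mulr0.
  by apply/eqP; rewrite -normr_le0 -v0 coord_le_enorm.
have a0 : 0 < enorm x by rewrite lt_def x0 enorm_ge0.
have b0 : 0 < enorm v by rewrite lt_def v0 enorm_ge0.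
have ab : 0 < 2 * (enorm x * enorm v) by rewrite !mulr_gt0.
rewrite -(ler_pM2l ab) mulr_sumr.
have -> : 2 * (enorm x * enorm v) * (enorm x * enorm v) =
    enorm v ^+ 2 * (\sum_(i < d) x ord0 i ^+ 2) +
    enorm x ^+ 2 * (\sum_(i < d) v ord0 i ^+ 2).
  by rewrite -!sqr_enorm; ring.
rewrite !mulr_sumr -big_split/=.
apply: ler_sum => i _.
have := sqr_ge0 (enorm v * x ord0 i - enorm x * v ord0 i); nra.
Qed.

(** Expand [|x + y|^2] as the dot products of [x] and of [y] with [x + y], apply Cauchy-Schwarz to
    each and divide by [|x + y|]. *)
Lemma enormD x y : enorm (x + y) <= enorm x + enorm y.
Proof.
have [->|n0] := eqVneq (enorm (x + y)) 0; first by rewrite addr_ge0 ?enorm_ge0.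
have np : 0 < enorm (x + y) by rewrite lt_def n0 enorm_ge0.
rewrite -(ler_pM2r np) -expr2 sqr_enorm mulrDl.
apply: le_trans (lerD (dot_le_enorm _ _) (dot_le_enorm _ _)).
by rewrite -big_split/=; apply: ler_sum => i _; rewrite !mxE expr2 mulrDl.
Qed.

Lemma enorm_continuous : continuous (@enorm R d).
Proof.
move=> x; apply: (@continuous_comp _ _ _ _ Num.sqrt); last exact: sqrt_continuous.
apply: continuous_bigsum => i.
apply: (@continuous_comp _ _ _ (fun y : 'rV[R]_d => y ord0 i) (fun t : R => t ^+ 2)).
  exact: coord_continuous.
exact: exprn_continuous.
Qed.

End euclidean_norm.

(** * Volume of balls *)

Section volume.
Context {R : realType} {d : nat}.
Implicit Types (x u : 'rV[R]_d) (q : 'rV[R]_d * 'rV[R]_d) (l : R).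

Definition cube u l : set 'rV[R]_d :=
  [set x | forall i, x ord0 i \in `]u ord0 i, u ord0 i + l]].

Let side q (i : 'I_d) : R := Num.max 0 (q.2 ord0 i - q.1 ord0 i).
Let slab q (i : 'I_d) (t : R) : R := \1_(`]q.1 ord0 i, q.2 ord0 i]%classic) t.

(* The indicator of [box q] with the first [k] coordinates integrated out. *)
Let partial_volume q (k : nat) x : R :=
  \prod_(i < d) (if (i < k)%N then side q i else slab q i (x ord0 i)).

Let side_ge0 q i : 0 <= side q i.
Proof. by rewrite le_max lexx. Qed.

Let slab_ge0 q i t : 0 <= slab q i t.
Proof. by rewrite /slab indicE ler0n. Qed.

Let partial_volume_ge0 q k x : 0 <= partial_volume q k x.
Proof. by apply: prodr_ge0 => i _; case: ifP. Qed.

Let measure_slab q i (a b : R) :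
  (lebesgue_measure (`]q.1 ord0 i, q.2 ord0 i] `&` `]a, b])%classic <=
   (side q i)%:E)%E.
Proof.
apply: (@le_trans _ _ (lebesgue_measure (`]q.1 ord0 i, q.2 ord0 i]%classic : set R))).
  by apply: le_measure; rewrite ?inE//; exact: measurableI.
rewrite lebesgue_measure_itv/= /side; case: ifPn; rewrite lte_fin.
  by move=> _; rewrite lee_fin le_max lexx orbT.
by rewrite lee_fin le_max lexx.
Qed.

(** For a covering, the sum of the box indicators is at least 1 on the cube. Integrating out one
    coordinate at a time over an interval of length [l] gains a factor [l] on the left and turns one
    slab indicator into at most a side length on the right. After [d] steps the right side is the
    total volume. *)
Lemma lebesgue_outer_cube u l : 0 < l -> ((l ^+ d)%:E <= lebesgue_outer (cube u l))%E.
Proof.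
move=> l0; apply: le_ereal_inf_tmp => _ [C [cC uC] <-].
have [B /card_set_bijP[e Be]] : exists B : set nat, (B #= C)%card.
  by have /countable_bijP[B CB] := cC; exists B; rewrite card_eq_sym.
(* The covering is enumerated by [B]; the weight [c] switches off the other indices, so that series
   over all naturals can be used. *)
pose c n : R := (n \in B)%:R.
have c0 n : 0 <= c n by rewrite ler0n.
pose F k n x := (c n * partial_volume (e n) k x)%:E.
have F0 k n x : (0 <= F k n x)%E by rewrite lee_fin mulr_ge0.
have step k : (k <= d)%N -> forall x, cube u l x ->
    ((l ^+ k)%:E <= \sum_(n <oo) F k n x)%E.
  elim: k => [_ x ux|k IHk kd x ux].
    have [q Cq xq] := uC _ ux.
    have [n Bn eq] := (set_bij_surj Be) _ Cq.
    rewrite (nneseriesD1 (n := n))// -[leLHS]adde0 leeD//.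
      rewrite lee_fin /c mem_set// mul1r expr0 /partial_volume big1// => i _.
      rewrite /= /slab indicE mem_set//=; last by rewrite eq; exact: xq.
    by apply: nneseries_ge0 => *; exact: F0.
  pose j := Ordinal kd.
  (* Only coordinate [j], of index [k], varies. The factor [a n] collects the other coordinates and
     is common to stages [k] and [k + 1]. *)
  pose y t := \row_i (if i == j then t else x ord0 i).
  have uy t : `]u ord0 j, u ord0 j + l]%classic t -> cube u l (y t).
    by move=> ut i; rewrite mxE; case: eqP => [->|_]; [exact: ut|exact: ux].
  pose a n := c n * \prod_(i < d | i != j)
    (if (i < k)%N then side (e n) i else slab (e n) i (x ord0 i)).
  have a0 n : 0 <= a n.
    by rewrite mulr_ge0// prodr_ge0// => i _; case: ifP.
  have Fy n t : F k n (y t) = ((a n)%:E * (slab (e n) j t)%:E)%E.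
    rewrite /F /partial_volume (bigD1 j)//= ltnn mxE eqxx -EFinM; congr EFin.
    rewrite /a [slab _ _ _ * _]mulrC mulrA; congr (_ * _ * _).
    by apply: eq_bigr => i ij; rewrite mxE (negbTE ij).
  have FS n : F k.+1 n x = ((a n)%:E * (side (e n) j)%:E)%E.
    rewrite /F /partial_volume (bigD1 j)//= ltnSn -EFinM; congr EFin.
    rewrite /a [side _ _ * _]mulrC mulrA; congr (_ * _ * _).
    apply: eq_bigr => i ij; rewrite ltnS leq_eqVlt.
    suff -> : (nat_of_ord i == k) = false by [].
    by apply: contraNF ij => /eqP ik; apply/eqP/val_inj.
  pose I : set R := `]u ord0 j, u ord0 j + l]%classic.
  have mI : measurable I by exact: measurable_itv.
  have muI : lebesgue_measure I = l%:E.
    by rewrite lebesgue_measure_itv/= lte_fin ltrDl l0 -EFinD addrAC subrr add0r.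
  have mF n : measurable_fun I ((fun t => F k n (y t)) : R -> \bar R).
    under eq_fun do rewrite Fy.
    by apply: measurable_funeM; apply/measurable_EFinP; exact: measurable_indic.
  (* The induction hypothesis holds at every [y t], so the constant [l ^ k] can be integrated over
     [I]; sum and integral are then exchanged by nonnegativity. *)
  apply: (@le_trans _ _ (\int[lebesgue_measure]_(t in I) \sum_(n <oo) F k n (y t)))%E.
    rewrite exprSr EFinM -muI -integral_cst//; apply: ge0_le_integral => //=.
    - by move=> t _; rewrite lee_fin exprn_ge0// ltW.
    - by apply: (@ge0_emeasurable_sum _ _ _ I _ xpredT) => [n t _ _|n _]; [exact: F0|exact: mF].
    - by move=> t It; apply: IHk; [exact: ltnW|exact: uy].
  rewrite integral_nneseries//; apply: lee_nneseries => [n _ _|n _].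
    by apply: integral_ge0 => t _.
  under eq_integral do rewrite Fy.
  rewrite ge0_integralZl//; last 3 first.
  - by apply/measurable_EFinP; exact: measurable_indic.
  - by move=> t _; rewrite lee_fin.
  - by rewrite lee_fin.
  rewrite FS /slab integral_indic//; apply: lee_wpmul2l; first by rewrite lee_fin.
  exact: measure_slab.
rewrite (reindex_esum _ _ _ _ Be).
(* At stage [d] nothing depends on the point any more; the upper corner is one that lies in the
   half-open cube. *)
apply: (le_trans (step d (leqnn d) (\row_i (u ord0 i + l)) _)).
  by move=> i; rewrite mxE in_itv/= ltrDl l0 lexx.
rewrite nneseries_esumT; last by move=> n; exact: F0.
rewrite [leRHS]esum_mkcond; apply: le_esum => n _.
rewrite /F /c; case: ifP => [_|_]; last by rewrite mul0r.
rewrite mul1r lee_fin /partial_volume /box_volume le_eqVlt; apply/orP; left.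
by apply/eqP/eq_bigr => i _; rewrite ltn_ord.
Qed.

End volume.

(** * Volumes of Euclidean balls and of sets between two of them *)

Section ball_volume.
Context {R : realType} {d : nat}.
Implicit Types (x : 'rV[R]_d) (E : set 'rV[R]_d).

Lemma lebesgue_outer_eball_le x (r : R) : 0 < r ->
  (lebesgue_outer (eball x r) <= ((2 * r) ^+ d)%:E)%E.
Proof.
move=> r0.
pose q : 'rV[R]_d * 'rV[R]_d := (\row_i (x ord0 i - r), \row_i (x ord0 i + r)).
apply: ereal_inf_lbound; exists [set q].
  split; first exact: countable1.
  move=> y /= xy; exists q => // i; rewrite !mxE in_itv/=.
  have := le_lt_trans (coord_le_enorm (y - x) i) xy.
  by rewrite !mxE ltr_norml => /andP[? ?]; apply/andP; split; lra.
rewrite esum_set1 ?lee_fin ?box_volume_ge0//; congr EFin.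
rewrite /box_volume -[in RHS](card_ord d) -prodr_const; apply: eq_bigr => i _.
rewrite !mxE max_r; lra.
Qed.

(** The cube with corner [x] and side [l = r / (d + 1)] lies in the ball, since there
    [|y - x|^2 <= d l^2 < (d + 1)^2 l^2 = r^2]. *)
Lemma lebesgue_outer_eball_ge x (r : R) : 0 < r ->
  (((r / d.+1%:R) ^+ d)%:E <= lebesgue_outer (eball x r))%E.
Proof.
move=> r0; pose l := r / d.+1%:R; have l0 : 0 < l by rewrite divr_gt0.
apply: (le_trans (lebesgue_outer_cube x l0)); apply: le_lebesgue_outer => y xy.
have {1}-> : r = d.+1%:R * l by rewrite mulrC divfK.
have dl : 0 < d.+1%:R * l by rewrite mulr_gt0.
rewrite /eball/= -ltr_sqr ?nnegrE ?enorm_ge0 ?(ltW dl)// sqr_enorm.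
apply: (@le_lt_trans _ _ (\sum_(i < d) l ^+ 2)).
  apply: ler_sum => i _; have := xy i; rewrite in_itv/= !mxE => /andP[? ?].
  by rewrite ler_sqr ?nnegrE//; [lra|lra|exact: ltW].
rewrite sumr_const card_ord -(mulr_natl (l ^+ 2)) [ltRHS]exprMn ltr_pM2r ?exprn_gt0//.
by rewrite -natrX ltr_nat (leq_trans (ltnSn d))// expnS expn1 leq_pmulr.
Qed.

(** [lebesgue_Rd] is the outer measure on every set, so monotonicity alone traps the volume of an
    Agmon ball and makes it finite. *)
Lemma volume_between x (r s : R) E : 0 < r -> 0 < s ->
  eball x r `<=` E -> E `<=` eball x s ->
  exists v, [/\ @lebesgue_Rd R d E = v%:E, (r / d.+1%:R) ^+ d <= v &
                v <= (2 * s) ^+ d].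
Proof.
move=> r0 s0 rE Es.
have l1 := le_trans (lebesgue_outer_eball_ge x r0) (le_lebesgue_outer rE).
have l2 := le_trans (le_lebesgue_outer Es) (lebesgue_outer_eball_le x s0).
rewrite /lebesgue_Rd; move: l1 l2; case: (lebesgue_outer E) => // v.
by rewrite !lee_fin => l1 l2; exists v.
Qed.

End ball_volume.

(** * Bounds on the Agmon distance *)

(* No measurability is needed: the integral of a nonnegative function is the
   supremum of the integrals of the simple functions below it. *)
Lemma le_integral_nonmeasurable disp (T : measurableType disp) (R : realType)
    (mu : {measure set T -> \bar R}) (D E : set T) (f g : T -> \bar R) :
  (forall x, D x -> (0 <= f x)%E) -> (forall x, E x -> (0 <= g x)%E) ->
  D `<=` E -> (forall x, D x -> (f x <= g x)%E) ->
  (\int[mu]_(x in D) f x <= \int[mu]_(x in E) g x)%E.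
Proof.
move=> f0 g0 DE fg; rewrite !ge0_integralE//.
apply: ereal_sup_le => _ [h /= hf <-]; exists h => //= x.
apply: le_trans (hf x) _; rewrite !patchE.
have [xD|xD] := boolP (x \in D).
  by rewrite mem_set; [apply: fg; exact: set_mem|apply: DE; exact: set_mem].
by case: ifPn => // xE; apply: g0; exact: set_mem.
Qed.

(** The times at which [f] is at least [r] form a nonempty compact set; [c] is its minimum. *)
Lemma first_exit (R : realType) (a b r : R) (f : R -> R) : a <= b ->
  {within `[a, b], continuous f} -> r <= f b ->
  exists c, [/\ c \in `[a, b], r <= f c & forall t, a <= t < c -> f t < r].
Proof.
move=> ab cf rb; pose A := `[a, b]%classic `&` f @^-1` [set u | r <= u].
have cA : compact A.
  have /continuous_closedP/(_ _ (@closed_ge _ r))/closed_subspaceP[V cV VA] := cf.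
  rewrite /A setIC -VA setIC.
  by apply: compact_closedI => //; exact: segment_compact.
have A0 : A !=set0.
  by exists b; split => //=; rewrite in_itv/= ab lexx.
have [|c] := @compact_EVT_min _ _ (@idfun R) A A0 cA.
  by apply: continuous_subspaceT => x; exact: cvg_id.
rewrite inE => -[cab]; move=> /= rc cmin.
exists c; split => // t /andP[at_ tc]; rewrite ltNge; apply/negP => rt.
have : c <= t.
  apply: cmin; rewrite inE; split => //=; rewrite in_itv/= at_/=.
  by move: cab; rewrite /= in_itv/= => /andP[_]; apply: le_trans; exact: ltW.
by rewrite leNgt tc.
Qed.

(** * Arc length dominates the chord *)

Section curves.
Context {R : realType} {d : nat}.
Implicit Types (x y v : 'rV[R]_d) (g : R -> 'rV[R]_d).
Local Notation mu := (@lebesgue_measure R).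

Definition speed g (t : R) : R := enorm (derive1 g t).

Lemma speed_ge0 g t : 0 <= speed g t. Proof. exact: enorm_ge0. Qed.
Local Hint Resolve speed_ge0 : core.

Lemma enorm_comp_continuous (T : topologicalType) (g : T -> 'rV[R]_d) :
  continuous g -> continuous (fun t => enorm (g t)).
Proof. by move=> cg t; apply: continuous_comp; [exact: cg|exact: enorm_continuous]. Qed.

Lemma dot_comp_continuous (T : topologicalType) (g : T -> 'rV[R]_d) v :
  continuous g -> continuous (fun t => \sum_(i < d) v ord0 i * g t ord0 i).
Proof.
move=> cg t; apply: continuous_bigsum => i; apply: continuousM.
  exact: cst_continuous.
apply: (@continuous_comp _ _ _ g (fun y : 'rV[R]_d => y ord0 i)); first exact: cg.
exact: coord_continuous.
Qed.

Lemma is_derive_dot g v (t : R) (l : 'rV[R]_d) : is_derive t 1 g l ->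
  is_derive t 1 (fun s => \sum_(i < d) v ord0 i * g s ord0 i)
    (\sum_(i < d) v ord0 i * l ord0 i).
Proof.
move=> gl; have dg : derivable g t 1 by [].
have -> : (fun s => \sum_(i < d) v ord0 i * g s ord0 i) =
    \sum_(i < d) (v ord0 i \*: (fun s => g s ord0 i : R^o)).
  by apply/funext => s; rewrite fct_sumE.
apply: is_derive_sum => i; apply: is_deriveZ; apply: DeriveDef.
  exact: (derivable_mxP g t 1).1.
by have := derive_mx dg; rewrite derive_val => ->; rewrite mxE.
Qed.

(** Project the curve onto the unit vector [v] along the chord: the fundamental theorem of calculus
    gives the chord length as the integral of [v . g'], which Cauchy-Schwarz bounds by the speed. *)
Lemma C1_segment_speed (a b : R) g : a < b -> C1_segment a b g ->
  measurable_fun `[a, b]%classic (speed g) /\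
  ((enorm (g b - g a))%:E <= \int[mu]_(t in `[a, b]) (speed g t)%:E)%E.
Proof.
move=> ab [cg [g' cg' dg]].
have sE t : t \in `]a, b[ -> speed g t = enorm (g' t).
  by move=> /dg gt; rewrite /speed derive1E derive_val.
have cN : {within `[a, b], continuous (fun t => enorm (g' t))}.
  exact: enorm_comp_continuous.
have mN : measurable_fun `[a, b]%classic (fun t => enorm (g' t)).
  exact: subspace_continuous_measurable_fun.
have mNo : measurable_fun `]a, b[%classic (fun t => enorm (g' t)).
  by apply: measurable_funS mN => //; exact: subset_itv_oo_cc.
have ms : measurable_fun `]a, b[%classic (speed g).
  by apply: eq_measurable_fun mNo => t; rewrite inE => /sE ->.
split; first exact: measurable_fun_itv_cc ms.
(* The derivative is known to be [g'] only on the open interval; the endpoints are dropped to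
   replace the speed by [|g'|], then restored because [|g'|] is continuous on the closed
   interval. *)
rewrite integral_itv_bndoo; last exact/measurable_EFinP.
under eq_integral => t do [rewrite inE => /sE ->].
rewrite -(@integral_itv_bndoo _ a b _ true false); last exact/measurable_EFinP.
have [->|n0] := eqVneq (enorm (g b - g a)) 0.
  by apply: integral_ge0 => t _; rewrite lee_fin enorm_ge0.
have np : 0 < enorm (g b - g a) by rewrite lt_def n0 enorm_ge0.
pose v := (enorm (g b - g a))^-1 *: (g b - g a).
have nv : enorm v = 1 by rewrite enormZ ger0_norm ?invr_ge0 ?enorm_ge0// mulVf.
pose dot y := \sum_(i < d) v ord0 i * y ord0 i.
have cdot' : {within `[a, b], continuous (dot \o g')} by exact: dot_comp_continuous.
have cdot : {within `[a, b], continuous (dot \o g)} by exact: dot_comp_continuous.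
have dotE : enorm (g b - g a) = dot (g b) - dot (g a).
  rewrite /dot -sumrB; under eq_bigr do rewrite -mulrBr /v mxE -mulrA mulrA.
  apply: (mulfI n0); rewrite -expr2 sqr_enorm mulr_sumr.
  by apply: eq_bigr => i _; rewrite !mxE -!mulrA mulVKf.
rewrite dotE EFinB.
rewrite -(@continuous_FTC2 _ (dot \o g') (dot \o g) a b ab cdot').
- apply: le_integral => //=.
  + by apply: continuous_compact_integrable => //; exact: segment_compact.
  + by apply: continuous_compact_integrable => //; exact: segment_compact.
  + by move=> t _; rewrite lee_fin (le_trans (dot_le_enorm _ _))// nv mul1r.
- have /(continuous_within_itvP _ ab)[_ ca cb] := cdot; split => // t tab.
  by have [] := is_derive_dot v (dg t tab).
- by move=> t tab; have ? := is_derive_dot v (dg t tab); rewrite derive1E derive_val.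
Qed.

Lemma C1_segment_subl (a s b : R) g : s <= b -> C1_segment a b g -> C1_segment a s g.
Proof.
move=> sb [cg [g' cg' dg]].
have sub : `[a, s] `<=` `[a, b] by apply: subset_itvl; rewrite bnd_simp.
split; first exact: continuous_subspaceW sub cg.
exists g'; first exact: continuous_subspaceW sub cg'.
move=> t; rewrite in_itv/= => /andP[at_ ts]; apply: dg.
by rewrite in_itv/= at_ (lt_le_trans ts).
Qed.

(** Induction on the number of pieces, with the triangle inequality at the last node. The chord
    bound covers every intermediate time [s] because it is applied at a first exit time. *)
Lemma piecewise_C1_speed (n : nat) (t : nat -> R) g :
  (forall i, (i < n)%N -> t i < t i.+1 /\ C1_segment (t i) (t i.+1) g) ->
  [/\ t 0%N <= t n, {within `[t 0%N, t n], continuous g},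
    measurable_fun `[t 0%N, t n]%classic (speed g) &
    forall s, s \in `[t 0%N, t n] -> ((enorm (g s - g (t 0%N)))%:E <=
      \int[mu]_(z in `[t 0%N, s]) (speed g z)%:E)%E].
Proof.
elim: n => [|n IHn] tg.
  split => //.
  - by rewrite set_itv1; exact: continuous_subspace1.
  - by rewrite set_itv1; exact: measurable_fun_set1.
  - move=> s; rewrite in_itv/= => s0; have -> : s = t 0%N by apply/eqP; rewrite eq_le andbC.
    by rewrite subrr enorm0; apply: integral_ge0 => z _; rewrite lee_fin.
have [i ni|t0n cg mg ig] := IHn; first by apply: tg; exact: ltnW.
have [tnS Cg] := tg n (ltnSn n).
have [mS _] := C1_segment_speed tnS Cg.
have t0S := le_trans t0n (ltW tnS).
have splitE (s : R) : t n <= s ->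
    `[t 0%N, s]%classic = `[t 0%N, t n] `|` `[t n, s] :> set R.
  move=> ns; apply/seteqP; split => z /=; rewrite !in_itv/=.
    by move=> /andP[z0 zs]; have [zn|/ltW zn] := leP z (t n); [left|right]; apply/andP.
  by case=> /andP[z1 z2]; apply/andP; split => //; [exact: le_trans z2 _|exact: le_trans z1].
split => //.
- rewrite splitE ?(ltW tnS)//; apply: withinU_continuous => //.
  1,2: exact: interval_closed.
  by have [] := Cg.
- by rewrite splitE ?(ltW tnS)//; apply/measurable_funU.
- move=> s; rewrite in_itv/= => /andP[s0 sS].
  have [sn|ns] := leP s (t n); first by apply: ig; rewrite in_itv/= s0.
  have [ms ints] := C1_segment_speed ns (C1_segment_subl sS Cg).
  have msO : measurable_fun `]t n, s]%classic (speed g).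
    by apply: measurable_funS ms => //; exact: subset_itv_oc_cc.
  have splitO : `[t 0%N, s]%classic = `[t 0%N, t n] `|` `]t n, s] :> set R.
    rewrite (@itv_bndbnd_setU _ _ (BLeft (t 0%N)) (BRight (t n)) (BRight s)) ?bnd_simp//.
    exact: ltW.
  rewrite splitO ge0_integral_setU//=; last 3 first.
  + by apply/measurable_EFinP; apply/measurable_funU.
  + by move=> z _; rewrite lee_fin.
  + rewrite disj_set2E; apply/eqP/seteqP; split => z //=; rewrite !in_itv/=.
    by move=> [/andP[_ z1] /andP[z2 _]]; move: z2; rewrite ltNge z1.
  rewrite integral_itv_obnd_cbnd; last exact/measurable_EFinP.
  have -> : g s - g (t 0%N) = (g (t n) - g (t 0%N)) + (g s - g (t n)).
    by rewrite [RHS]addrC subrKA.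
  have le0 := enormD (g (t n) - g (t 0%N)) (g s - g (t n)).
  rewrite -lee_fin EFinD in le0; apply: (le_trans le0).
  by apply: leeD => //; apply: ig; rewrite in_itv/= t0n lexx.
Qed.

(** * Agmon distance against Euclidean distance *)

Section agmon_bounds.
Variables (rho : 'rV[R]_d -> R) (k0 B0 : R).
Hypothesis hrho : critical_radius k0 B0 rho.

Let rho_gt0 x : 0 < rho x. Proof. by have [] := hrho. Qed.
Let B0_gt0 : 0 < B0. Proof. by have [_ B1 _ _] := hrho; apply: lt_trans B1. Qed.
Let k0_gt0 : 0 < k0. Proof. by have [k1 _ _ _] := hrho; apply: lt_trans k1. Qed.

(* Up to its first exit from the ball of radius [s * rho x], a curve has
   Euclidean length at least [s * rho x] and the weight is bounded below. *)
Lemma agmon_dist_ge x y (s : R) : 0 < s -> s * rho x <= enorm (y - x) ->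
  ((s / (B0 * (1 + s) `^ (k0 / (k0 + 1))))%:E <= agmon_dist rho x y)%E.
Proof.
move=> s0 sxy; apply: le_ereal_inf_tmp => _ [g [[n [t [t0 tn tS]]] g0 g1] <-].
have [_ cg mg ig] := piecewise_C1_speed tS.
rewrite t0 tn in cg mg ig.
have cf : {within `[0, 1], continuous (fun t => enorm (g t - x))}.
  apply: enorm_comp_continuous => z; apply: continuousB; first exact: cg.
  exact: cst_continuous.
have [|c [c01 sc cs]] := @first_exit R 0 1 (s * rho x) _ ler01 cf.
  by rewrite g1.
have c01' : `[0, c[ `<=` `[0, 1].
  by apply: subset_itvl; rewrite bnd_simp; move: c01; rewrite in_itv/= => /andP[].
have mo : measurable_fun `[0, c[%classic (speed g) by exact: measurable_funS mg.
have kap0 : 0 <= k0 / (k0 + 1) by rewrite divr_ge0 ?addr_ge0// ltW.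
have p0 : 0 < (1 + s) `^ (k0 / (k0 + 1)) by rewrite powR_gt0// addr_gt0.
(* [K] bounds [1 / rho] from below along the curve on [[0, c[], where it is still inside the ball,
   by the upper inequality of [critical_radius]. *)
pose K := (B0 * rho x * (1 + s) `^ (k0 / (k0 + 1)))^-1.
have K0 : 0 < K by rewrite invr_gt0 !mulr_gt0.
apply: (@le_trans _ _ (\int[mu]_(z in `[0%R, c[) (K%:E * (speed g z)%:E))%E).
  rewrite ge0_integralZl//; last 3 first.
  - exact/measurable_EFinP.
  - by move=> z _; rewrite lee_fin.
  - by rewrite lee_fin ltW.
  rewrite integral_itv_bndo_bndc; last exact/measurable_EFinP.
  have := ig c c01; rewrite g0 => le1.
  apply: (@le_trans _ _ (K%:E * (s * rho x)%:E)%E).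
    rewrite -EFinM lee_fin /K le_eqVlt; apply/orP; left; apply/eqP.
    by field; rewrite !gt_eqF.
  by rewrite lee_pmul2l//; apply: le_trans le1; rewrite lee_fin.
apply: le_integral_nonmeasurable => //.
- by move=> z _; rewrite -EFinM lee_fin mulr_ge0// ltW.
- by move=> z _; rewrite lee_fin mulr_ge0 ?enorm_ge0// invr_ge0 ltW.
move=> z; rewrite /= in_itv/= => /cs fz; rewrite -EFinM lee_fin.
apply: ler_wpM2r; first exact: enorm_ge0.
rewrite /K lef_pV2 ?posrE ?mulr_gt0//.
have [_ _ _ /(_ x (g z))[_ le2]] := hrho.
apply: (le_trans le2); rewrite ler_wpM2l ?mulr_ge0 ?(ltW B0_gt0) ?(ltW (rho_gt0 _))//.
have e0 : 0 <= enorm (x - g z) / rho x by rewrite divr_ge0 ?enorm_ge0// ltW.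
apply: ge0_ler_powR => //; rewrite ?nnegrE; [lra|lra|].
by rewrite lerD2l ler_pdivrMr// enormC ltW.
Qed.

(** Test with the straight segment: its speed is constantly [|y - x|], and the lower inequality of
    [critical_radius] bounds [1 / rho] along it by [B0 (1 + s)^k0 / rho x]. *)
Lemma agmon_dist_le x y (s : R) : 0 <= s -> enorm (y - x) <= s * rho x ->
  (agmon_dist rho x y <= (B0 * s * (1 + s) `^ k0)%:E)%E.
Proof.
move=> s0 sxy; pose g (t : R) := x + t *: (y - x).
have dg (t : R) : is_derive t (1 : R) (g : R -> 'rV[R]_d) (y - x).
  rewrite -[y - x in X in is_derive _ _ _ X]add0r.
  apply: (@is_deriveD _ _ _ (cst x) (fun z : R => z *: (y - x))).
  have dz : is_diff t (fun z : R => z *: (y - x)) (fun z => z *: (y - x)).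
    exact: is_diff_scalel.
  apply: DeriveDef; first by apply: diff_derivable; case: dz.
  by rewrite deriveE ?diff_val ?scale1r//; case: dz.
have cg : continuous g.
  move=> t; apply: differentiable_continuous; apply/derivable1_diffP.
  by have [] := dg t.
apply: (@le_trans _ _ (agmon_length rho g)).
  apply: ereal_inf_lbound; exists g => //; split.
  - exists 1%N, (fun i => i%:R); split => // -[|//] _; split => //; split.
      exact: continuous_subspaceT.
    by exists (cst (y - x)) => //; apply: continuous_subspaceT; exact: cst_continuous.
  - by rewrite /g scale0r addr0.
  - by rewrite /g scale1r addrC subrK.
apply: (@le_trans _ _ (\int[mu]_(z in `[0%R, 1%R]) (cst (B0 * s * (1 + s) `^ k0)%:E z))%E).
  have U0 : 0 <= B0 * s * (1 + s) `^ k0.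
    by rewrite !mulr_ge0 ?powR_ge0// ltW.
  apply: le_integral_nonmeasurable => //.
  - by move=> z _; rewrite lee_fin mulr_ge0 ?enorm_ge0// invr_ge0 ltW.
  move=> z; rewrite /= in_itv/= => /andP[z0 z1]; rewrite lee_fin derive1E derive_val.
  have [_ _ _ /(_ x (g z))[le1 _]] := hrho.
  have gx : enorm (x - g z) <= s * rho x.
    rewrite enormC /g addrAC subrr add0r enormZ ger0_norm//.
    by apply: le_trans sxy; rewrite ler_piMl ?enorm_ge0.
  have e0 : 0 <= enorm (x - g z) / rho x by rewrite divr_ge0 ?enorm_ge0// ltW.
  have le2 : B0^-1 * rho x * (1 + s) `^ (- k0) <= rho (g z).
    apply: le_trans le1; rewrite ler_wpM2l ?mulr_ge0 ?invr_ge0 ?(ltW B0_gt0) ?(ltW (rho_gt0 _))//.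
    have s1 : 0 < 1 + s by lra.
    have e1 : 0 < 1 + enorm (x - g z) / rho x by lra.
    rewrite !powRN lef_pV2 ?posrE ?powR_gt0//.
    apply: ge0_ler_powR; rewrite ?nnegrE; [exact: ltW|exact: ltW|exact: ltW|].
    by rewrite lerD2l ler_pdivrMr.
  have p0 : 0 < (1 + s) `^ k0 by rewrite powR_gt0//; lra.
  have q0 : 0 < B0^-1 * rho x * (1 + s) `^ (- k0).
    by rewrite powRN !mulr_gt0 ?invr_gt0.
  apply: (@le_trans _ _ ((B0^-1 * rho x * (1 + s) `^ (- k0))^-1 * (s * rho x))).
    by apply: ler_pM; rewrite ?enorm_ge0 ?invr_ge0 ?(ltW (rho_gt0 _))// lef_pV2 ?posrE.
  rewrite powRN le_eqVlt; apply/orP; left; apply/eqP.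
  by field; rewrite !gt_eqF.
by rewrite integral_cst//= lebesgue_measure_itv/= lte_fin ltr01 oppr0 addr0 mule1.
Qed.

End agmon_bounds.

End curves.

(** * Weighted means *)

(** Reduces an inclusion of classes to choosing, for each ball of one family, a ball of the other
    with the same centre, with a constant uniform in centre and radius. *)
Lemma ereal_sup_transfer (R : realType) (T : Type) (F G : T -> R -> \bar R) (K : R) :
  0 <= K ->
  (forall x r, 0 < r -> exists2 r', 0 < r' & (F x r <= K%:E * G x r')%E) ->
  (ereal_sup [set G x r | x in [set: T] & r in [set r : R | (0 < r)%R]] < +oo)%E ->
  (ereal_sup [set F x r | x in [set: T] & r in [set r : R | (0 < r)%R]] < +oo)%E.
Proof.
move=> K0 FG; set S := ereal_sup _ => Soo.
apply: (@le_lt_trans _ _ (K%:E * S)%E).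
  apply: ge_ereal_sup => _ [x _ [r r0 <-]]; have [r' r'0 le1] := FG x r r0.
  apply: (le_trans le1); rewrite lee_wpmul2l ?lee_fin//.
  by apply: ereal_sup_ubound; exists x => //; exists r'.
by rewrite lte_mul_pinfty ?lee_fin.
Qed.

Section weights.
Context {R : realType} {d : nat}.
Implicit Types (w : 'rV[R]_d -> R) (E : set 'rV[R]_d).
Local Notation mu := (@lebesgue_Rd R d).

(* [w] may be negative on a null set, and [E] need not be measurable. *)
Lemma wint_funepos w E : weight w ->
  wint w E = (\int[mu]_(x in E) ((fun x => (w x)%:E)^\+ x))%E.
Proof.
move=> [mw _ w0]; rewrite /wint integralE.
suff -> : (\int[mu]_(x in E) ((fun x => (w x)%:E)^\- x) = 0)%E by rewrite sube0.
apply/eqP; rewrite eq_le integral_ge0 ?andbT//.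
(* Enlarging [E] to the whole space provides a measurable domain for the almost-everywhere
   argument. *)
apply: (@le_trans _ _ (\int[mu]_(x in [set: lebesgue_space R d])
    ((fun x => (w x)%:E)^\- x))%E).
  by apply: le_integral_nonmeasurable.
rewrite (@ae_eq_integral _ _ _ mu setT (cst 0%E)) ?integral0//.
- by apply: measurable_funeneg; exact/measurable_EFinP.
- have FF : Filter (almost_everywhere (@lebesgue_Rd R d)) by exact: ae_filter_ringOfSetsType.
  apply: filterS w0 => x wx _; rewrite funenegE /= -EFin_max max_r// oppr_le0.
  exact: ltW.
Qed.

Lemma wint_ge0 w E : weight w -> (0 <= wint w E)%E.
Proof. by move=> hw; rewrite wint_funepos//; apply: integral_ge0. Qed.

Lemma le_wint w : weight w -> {homo wint w : E E' / E `<=` E' >-> (E <= E')%E}.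
Proof.
by move=> hw E E' sE; rewrite !wint_funepos//; exact: le_integral_nonmeasurable.
Qed.

Lemma dual_wint_ge0 (p : R) w E : (0 <= dual_wint p w E)%E.
Proof. by apply: integral_ge0 => x _; rewrite lee_fin powR_ge0. Qed.

Lemma le_dual_wint (p : R) w :
  {homo dual_wint p w : E E' / E `<=` E' >-> (E <= E')%E}.
Proof.
by move=> E E' sE; apply: le_integral_nonmeasurable => // x _; rewrite lee_fin powR_ge0.
Qed.

(** The exponents [1/p] and [(p - 1)/p] add up to 1, so the normalisation factors out with power
    one. *)
Lemma weighted_meanE (p N : R) w E : 1 < p -> 0 < N -> weight w ->
  weighted_mean p N%:E w E = (N^-1%:E *
    (wint w E `^ p^-1 * dual_wint p w E `^ ((p - 1) / p)))%E.
Proof.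
move=> p1 N0 hw; have p0 : 0 < p by apply: lt_trans p1.
have Ni : 0 < N^-1 by rewrite invr_gt0.
rewrite /weighted_mean inver gt_eqF// !poweRM ?lee_fin ?(ltW Ni) ?dual_wint_ge0 ?wint_ge0//.
rewrite muleACA; congr (_ * _)%E.
rewrite !poweR_EFin -EFinM -powRD; last by rewrite (gt_eqF Ni) implybT.
have -> : p^-1 + (p - 1) / p = 1 by field; rewrite gt_eqF.
by rewrite powRr1// ltW.
Qed.

Lemma weighted_mean_le (p N N' K : R) w E E' : 1 < p -> weight w ->
  0 < N -> 0 < N' -> 0 <= K -> N' <= K * N -> E `<=` E' ->
  (weighted_mean p N%:E w E <= K%:E * weighted_mean p N'%:E w E')%E.
Proof.
move=> p1 hw N0 N'0 K0 NN' sE; have p0 : 0 < p by apply: lt_trans p1.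
rewrite !weighted_meanE// [leRHS]muleA -EFinM; apply: lee_pmul.
- by rewrite lee_fin invr_ge0 ltW.
- by rewrite mule_ge0// poweR_ge0.
- by rewrite lee_fin ler_pdivlMr// mulrC ler_pdivrMr.
apply: lee_pmul; rewrite ?poweR_ge0//; apply: gt0_ler_poweR;
  rewrite ?in_itv/= ?leey ?andbT ?dual_wint_ge0 ?wint_ge0 ?le_dual_wint ?le_wint//.
- by rewrite invr_ge0 ltW.
- by rewrite divr_ge0// ?subr_ge0 ltW.
Qed.

End weights.

(** * The inclusions *)

(** The constant is the outer bound [(2 s')^d] for [F] divided by the inner bound [(r / (d + 1))^d]
    for [E]. *)
Lemma volume_ratio (R : realType) (d : nat) (x : 'rV[R]_d) (r s s' : R)
    (E F : set 'rV[R]_d) : 0 < r -> 0 < s -> 0 < s' ->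
  eball x r `<=` E -> E `<=` eball x s ->
  eball x r `<=` F -> F `<=` eball x s' ->
  exists v v', [/\ 0 < v, 0 < v', @lebesgue_Rd R d E = v%:E,
    @lebesgue_Rd R d F = v'%:E & v' <= (2 * d.+1%:R * (s' / r)) ^+ d * v].
Proof.
move=> r0 s0 s'0 rE Es rF Fs'.
have l0 : 0 < (r / d.+1%:R) ^+ d by rewrite exprn_gt0// divr_gt0.
have [v [Ev lv _]] := volume_between r0 s0 rE Es.
have [v' [Fv' lv' v'l]] := volume_between r0 s'0 rF Fs'.
exists v, v'; split => //; [exact: lt_le_trans lv|exact: lt_le_trans lv'|].
apply: (le_trans v'l); apply: (@le_trans _ _ ((2 * d.+1%:R * (s' / r)) ^+ d *
    (r / d.+1%:R) ^+ d)).
  rewrite -exprMn le_eqVlt; apply/orP; left; apply/eqP; congr (_ ^+ _).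
  by field; rewrite !gt_eqF.
by rewrite ler_wpM2l// exprn_ge0// mulr_ge0// divr_ge0// ltW.
Qed.

Lemma powRD1 (R : realType) (a x : R) : 0 < a -> a `^ (x + 1) = a `^ x * a.
Proof. by move=> a0; rewrite powRD ?powRr1 ?ltW// (gt_eqF a0) implybT. Qed.

(** Final comparison of normalisations: [v], [v'] are volumes with ratio of polynomial size [a],
    while [b] and [Y] are the exponential factors of the two classes. *)
Lemma ler_pM_absorb (R : realFieldType) (v v' b a X Y D K : R) :
  0 <= v -> 0 <= v' -> 0 <= b -> 0 <= D ->
  v' <= D * a * v -> b <= X -> a * X <= K * Y -> v' * b <= D * K * (v * Y).
Proof.
move=> v0 v'0 b0 D0 v'v bX aX; apply: (le_trans (ler_pM v'0 b0 v'v bX)).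
have -> : D * a * v * X = D * v * (a * X) by ring.
have -> : D * K * (v * Y) = D * v * (K * Y) by ring.
by rewrite ler_wpM2l// mulr_ge0.
Qed.

(** * Nesting of Agmon and Euclidean balls *)

Section inclusions.
Context {R : realType} {d : nat}.
Variables (rho : 'rV[R]_d -> R) (k0 B0 : R).
Hypothesis hrho : critical_radius k0 B0 rho.

Let rho_gt0 x : 0 < rho x. Proof. by have [] := hrho. Qed.
Let B0_gt1 : 1 < B0. Proof. by have [] := hrho. Qed.
Let B0_gt0 : 0 < B0. Proof. exact: lt_trans B0_gt1. Qed.
Let k0_gt0 : 0 < k0. Proof. by have [k1 _ _ _] := hrho; apply: lt_trans k1. Qed.
Let k01_gt0 : 0 < k0 + 1. Proof. exact: addr_gt0. Qed.

(** In units of [rho x], a Euclidean radius that no curve of Agmon length below [r] can reach: it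
    makes the lower bound of [agmon_dist_ge] at least [r]. *)
Definition exit_radius (r : R) : R := B0 `^ (k0 + 1) * r * (1 + r) `^ k0.

Lemma exit_radius_gt0 r : 0 < r -> 0 < exit_radius r.
Proof. by move=> r0; rewrite !mulr_gt0 ?powR_gt0// addr_gt0. Qed.

Lemma exit_radius_le r : 0 < r ->
  1 + exit_radius r <= B0 `^ (k0 + 1) * (1 + r) `^ (k0 + 1).
Proof.
move=> r0; have u0 : 0 < 1 + r by rewrite addr_gt0.
have A1 : 1 <= B0 `^ (k0 + 1).
  by rewrite -[leLHS](powRr0 B0) ler_powR// ltW.
have P1 : 1 <= (1 + r) `^ k0.
  by rewrite -[leLHS](powRr0 (1 + r)) ler_powR ?lerDl// ltW.
rewrite (powRD1 _ u0).
rewrite /exit_radius; nra.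
Qed.

(** Raising [exit_radius_le] to the power [k0 / (k0 + 1)] gives [B0^k0 (1 + r)^k0]; times [B0] this
    is exactly [exit_radius r / r]. *)
Lemma le_exit_length r : 0 < r ->
  r <= exit_radius r / (B0 * (1 + exit_radius r) `^ (k0 / (k0 + 1))).
Proof.
move=> r0; have u0 : 0 < 1 + r by rewrite addr_gt0.
have e0 := exit_radius_gt0 r0; have e1 : 0 < 1 + exit_radius r by rewrite addr_gt0.
have kap0 : 0 <= k0 / (k0 + 1) by rewrite divr_ge0 ?ltW.
rewrite ler_pdivlMr ?mulr_gt0 ?powR_gt0//.
have le1 : (1 + exit_radius r) `^ (k0 / (k0 + 1)) <= B0 `^ k0 * (1 + r) `^ k0.
  apply: (@le_trans _ _ ((B0 `^ (k0 + 1) * (1 + r) `^ (k0 + 1)) `^ (k0 / (k0 + 1)))).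
    apply: ge0_ler_powR => //; rewrite ?nnegrE ?exit_radius_le ?mulr_ge0 ?powR_ge0//.
    exact: ltW.
  rewrite powRM ?powR_ge0// -!powRrM.
  have -> : (k0 + 1) * (k0 / (k0 + 1)) = k0 by field; rewrite gt_eqF.
  exact: lexx.
apply: (@le_trans _ _ (r * (B0 * (B0 `^ k0 * (1 + r) `^ k0)))).
  by rewrite ler_pM2l// ler_pM2l.
rewrite /exit_radius (powRD1 _ B0_gt0).
by rewrite le_eqVlt; apply/orP; left; apply/eqP; ring.
Qed.

Lemma agmon_ball_sub x r : 0 < r ->
  agmon_ball rho x r `<=` eball x (exit_radius r * rho x).
Proof.
move=> r0 y; rewrite /agmon_ball /eball /= => yr; rewrite ltNge; apply/negP => le1.
have := agmon_dist_ge hrho (exit_radius_gt0 r0) le1.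
move=> /le_lt_trans/(_ yr); rewrite lte_fin ltNge => /negP; apply.
exact: le_exit_length.
Qed.

Lemma eball_sub_agmon x (s r : R) : 0 <= s -> B0 * s * (1 + s) `^ k0 < r ->
  eball x (s * rho x) `<=` agmon_ball rho x r.
Proof.
move=> s0 sr y; rewrite /eball /agmon_ball /= => /ltW ys.
by apply: le_lt_trans (agmon_dist_le hrho s0 ys) _; rewrite lte_fin.
Qed.

(** * The three inclusions *)

Variables (p : R) (hp : 1 < p).

Lemma Ap_infty_sub_H (c m : R) : 0 < c -> 0 < m ->
  Ap_infty rho p `<=` H_class rho p c m.
Proof.
move=> c0 m0 w [theta /= theta0 [hw [C C0 wC]]]; split => //.
(* With [al = 0] the exponential on the left is 1, leaving a pure power; [m / 2] is just an exponent
   strictly between 0 and [m]. *)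
have [K K0 HK] : exists2 K, 0 < K & forall u : R, 1 <= u ->
    u `^ theta * expR (0 * u `^ (m / 2)) <= K * expR (c * u `^ m).
  apply: powR_expR_absorb => //; lra.
apply: (@le_lt_trans _ _ (C * K)%:E); last exact: ltry.
apply: ge_ereal_sup => _ [x _ [r r0 <-]].
have [v [_ [v0 _ Ev _ _]]] := @volume_ratio R d x r r r _ _ r0 r0 r0
  (@subset_refl _ _) (@subset_refl _ _) (@subset_refl _ _) (@subset_refl _ _).
have u1 : 1 <= 1 + r / rho x by rewrite lerDl divr_ge0 ?ltW.
rewrite Ev -EFinM weighted_meanE ?mulr_gt0 ?expR_gt0//.
have := wC x r r0; rewrite Ev => le1.
apply: (@le_trans _ _ ((v * Phi rho m c x r)^-1%:E *
    (C%:E * v%:E * ((1 + r / rho x) `^ theta)%:E))%E).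
  by rewrite lee_pmul2l// lte_fin invr_gt0 mulr_gt0 ?expR_gt0.
rewrite -!EFinM lee_fin ler_pdivrMl ?mulr_gt0 ?expR_gt0//.
have := HK _ u1; rewrite mul0r expR0 mulr1 -/(Phi rho m c x r) => le2.
have -> : v * Phi rho m c x r * (C * K) = C * v * (K * Phi rho m c x r) by ring.
by rewrite ler_pM2l// mulr_gt0.
Qed.

(** The Agmon ball of radius [r] sits in the Euclidean ball of radius [s * rho x], with
    [s = exit_radius r] of order at most [(1 + r)^(k0 + 1)]. There [Phi] has exponent of order
    [(k0 + 1) m < 1] in [1 + r], which [expR (c2 * r)] absorbs. *)
Lemma H_sub_S (c1 c2 m : R) : 0 < c1 -> 0 < c2 -> 0 < m -> m < (k0 + 1)^-1 ->
  H_class rho p c1 m `<=` S_class rho p c2.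
Proof.
move=> c10 c20 m0 mk w [hw supH].
split; first exact: hw.
pose A := B0 `^ (k0 + 1); have A0 : 0 < A by rewrite powR_gt0.
(* Chosen for the inner radius [t = a r / u]: as [t <= 1], the bound [B0 t (1 + t)^k0] is at most
   [r / (2 u) < r]. *)
pose a := (B0 * 2 `^ (k0 + 1))^-1.
have P20 : 0 < 2 `^ (k0 + 1) :> R by rewrite powR_gt0.
have a0 : 0 < a by rewrite invr_gt0 mulr_gt0.
have [K K0 HK] : exists2 K, 0 < K & forall u : R, 1 <= u ->
    u `^ ((k0 + 1) * d%:R) * expR (c1 * A `^ m * u `^ ((k0 + 1) * m)) <=
    K * expR (c2 * u `^ 1).
  apply: powR_expR_absorb => //.
  - by rewrite mulr_ge0// ltW.
  - by rewrite mulr_ge0 ?powR_ge0// ltW.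
  - exact: mulr_gt0.
  - by rewrite -ltr_pdivlMl// mulr1.
pose D := (2 * d.+1%:R * (A / a)) ^+ d.
have D0 : 0 < D by rewrite exprn_gt0// !mulr_gt0// invr_gt0.
(* The factor [expR c2] pays for passing from [u = 1 + r] back to [r] in the exponential. *)
apply: (ereal_sup_transfer (K := D * (K * expR c2)) _ _ supH).
  by rewrite !mulr_ge0 ?expR_ge0// ltW.
move=> x r r0; pose u := 1 + r; have u0 : 0 < u by rewrite addr_gt0.
have u1 : 1 <= u by rewrite lerDl ltW.
pose s := exit_radius r; have s0 : 0 < s by exact: exit_radius_gt0.
pose t := a * (r / u); have t0 : 0 < t by rewrite mulr_gt0// divr_gt0.
have sr0 : 0 < s * rho x by rewrite mulr_gt0.
have tr0 : 0 < t * rho x by rewrite mulr_gt0.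
have ts : B0 * t * (1 + t) `^ k0 < r.
  have ru1 : r / u <= 1 by rewrite ler_pdivrMr// mul1r lerDr.
  have P21 : 1 <= 2 `^ (k0 + 1) :> R by rewrite -[leLHS](powRr0 2) ler_powR ?ler1n// ltW.
  have a1 : a <= 1 by rewrite invf_le1 ?mulr_gt0// mulr_ege1// ltW.
  have t1 : t <= 1 by rewrite -[leRHS]mulr1 ler_pM// ?divr_ge0// ltW.
  apply: (@le_lt_trans _ _ (B0 * t * 2 `^ k0)).
    rewrite ler_pM2l; last exact: mulr_gt0.
    apply: ge0_ler_powR; rewrite ?nnegrE; [exact: ltW|exact/ltW/addr_gt0|by []|].
    by rewrite -[leRHS]/(1 + 1) lerD2l.
  have -> : B0 * t * 2 `^ k0 = r / (2 * u).
    rewrite /t /a powRD1//.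
    by field; rewrite ?gt_eqF ?powR_gt0.
  have u20 : 0 < 2 * u by exact: mulr_gt0.
  rewrite ltr_pdivrMr// ltr_pMr//; apply: (le_lt_trans u1).
  by rewrite ltr_pMl// ltr1n.
have tsub := eball_sub_agmon (x := x) (ltW t0) ts.
have ssub := agmon_ball_sub (x := x) r0.
have [v [v' [v0 v'0 Ev Ev' vv']]] := @volume_ratio R d x (t * rho x) (s * rho x) (s * rho x)
  _ (eball x (s * rho x)) tr0 sr0 sr0 tsub ssub (subset_trans tsub ssub) (@subset_refl _ _).
exists (s * rho x) => //; rewrite Ev Ev' -!EFinM.
apply: weighted_mean_le; rewrite ?mulr_gt0 ?mulr_ge0 ?expR_gt0 ?expR_ge0 ?(ltW D0) ?(ltW K0)//.
(* Both [s] and [t] are linear in [r] near 0, so [r] cancels and [s / t = (A / a) u^(k0 + 1)]. *)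
have rat : (2 * d.+1%:R * (s * rho x / (t * rho x))) ^+ d = D * u `^ ((k0 + 1) * d%:R).
  rewrite powRrM powR_mulrn ?powR_ge0// -exprMn; congr (_ ^+ _).
  rewrite (powRD1 _ u0).
  rewrite /s /t /exit_radius -/A -/u.
  by field; rewrite ?gt_eqF.
have PhiE : Phi rho m c1 x (s * rho x) <= expR (c1 * A `^ m * u `^ ((k0 + 1) * m)).
  rewrite /Phi ler_expR -[leRHS]mulrA ler_pM2l// mulfK ?gt_eqF//.
  rewrite powRrM -powRM ?powR_ge0// ?(ltW A0)//.
  apply: ge0_ler_powR; rewrite ?nnegrE ?mulr_ge0 ?powR_ge0 ?(ltW m0) ?(ltW A0)//.
    by rewrite addr_ge0// ltW.
  exact: exit_radius_le.
rewrite rat in vv'.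
apply: ler_pM_absorb vv' PhiE _; rewrite ?expR_ge0 ?(ltW v0) ?(ltW v'0) ?(ltW D0)//.
by have := HK u u1; rewrite powRr1 ?(ltW u0)// mulrDr mulr1 expRD mulrA.
Qed.

(** The Euclidean ball of radius [s * rho x] sits in an Agmon ball of radius [r'] of order at most
    [(1 + s)^(k0 + 1)], so [expR (c2 * r')] is absorbed by [Phi], whose exponent has order
    [m > k0 + 1]. *)
Lemma S_sub_H (c2 c3 m : R) : 0 < c2 -> 0 < c3 -> k0 + 1 < m ->
  S_class rho p c2 `<=` H_class rho p c3 m.
Proof.
move=> c20 c30 mk w [hw supS].
split; first exact: hw.
pose A := B0 `^ (k0 + 1); have A0 : 0 < A by rewrite powR_gt0.
(* Growth exponent of [s' / s] for [s' = exit_radius r']: [r' / s] contributes [u^k0], and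
   [(1 + r')^k0] contributes [u^((k0 + 1) k0)]. *)
pose e := k0 + (k0 + 1) * k0.
have e0 : 0 < e by rewrite addr_gt0// mulr_gt0.
have [K K0 HK] : exists2 K, 0 < K & forall u : R, 1 <= u ->
    u `^ (e * d%:R) * expR (c2 * (2 * B0) * u `^ (k0 + 1)) <=
    K * expR (c3 * u `^ m).
  apply: powR_expR_absorb => //.
  - by rewrite mulr_ge0// ltW.
  - by rewrite mulr_ge0 ?mulr_ge0// ltW.
pose D := (2 * d.+1%:R * (A * (2 * B0) * (3 * B0) `^ k0)) ^+ d.
have D0 : 0 < D by rewrite exprn_gt0// !mulr_gt0// powR_gt0// mulr_gt0.
apply: (ereal_sup_transfer (K := D * K) _ _ supS).
  by rewrite mulr_ge0// ltW.
move=> x r r0; pose s := r / rho x; have s0 : 0 < s by rewrite divr_gt0.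
have sE : r = s * rho x by rewrite /s divfK// gt_eqF.
pose u := 1 + s; have u0 : 0 < u by rewrite addr_gt0.
have u1 : 1 <= u by rewrite lerDl ltW.
have P0 : 0 < u `^ k0 by rewrite powR_gt0.
(* The factor 2 makes the inequality required by [eball_sub_agmon] strict. *)
pose r' := 2 * (B0 * s * u `^ k0).
have U0 : 0 < B0 * s * u `^ k0 by rewrite mulr_gt0// mulr_gt0.
have r'0 : 0 < r' by exact: mulr_gt0.
have sr' : B0 * s * (1 + s) `^ k0 < r' by rewrite -/u /r' ltr_pMl// ltr1n.
have ssub := eball_sub_agmon (x := x) (ltW s0) sr'; rewrite -sE in ssub.
pose s' := exit_radius r'; have s'0 : 0 < s' by exact: exit_radius_gt0.
have sr'0 : 0 < s' * rho x by rewrite mulr_gt0.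
have s'sub := agmon_ball_sub (x := x) r'0.
have [v [v' [v0 v'0 Ev Ev' vv']]] := @volume_ratio R d x r r (s' * rho x)
  (eball x r) _ r0 r0 sr'0 (@subset_refl _ _) (@subset_refl _ _) ssub s'sub.
exists r' => //; rewrite Ev Ev' -!EFinM.
apply: weighted_mean_le; rewrite ?mulr_gt0 ?mulr_ge0 ?expR_gt0 ?expR_ge0 ?(ltW D0) ?(ltW K0)//.
have uk : u `^ (k0 + 1) = u `^ k0 * u by exact: powRD1.
have r'u : r' <= 2 * B0 * u `^ (k0 + 1).
  have -> : r' = 2 * B0 * (u `^ k0 * s) by rewrite /r'; ring.
  rewrite uk !ler_pM2l//; last by rewrite mulr_gt0.
  by rewrite lerDr.
have uk1 : 1 <= u `^ (k0 + 1).
  by rewrite -[leLHS](powRr0 u) ler_powR// ltW.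
have r'u1 : 1 + r' <= 3 * B0 * u `^ (k0 + 1).
  have Bu : 1 <= B0 * u `^ (k0 + 1) by rewrite mulr_ege1// ltW.
  move: r'u Bu; rewrite -!mulrA; lra.
have rat : s' * rho x / r <= A * (2 * B0) * (3 * B0) `^ k0 * u `^ e.
  have -> : s' * rho x / r = A * (2 * B0) * (u `^ k0 * (1 + r') `^ k0).
    rewrite sE /s' /exit_radius -/A {1}/r'.
    by field; rewrite ?gt_eqF.
  rewrite -[leRHS]mulrA ler_pM2l; last by rewrite !mulr_gt0.
  have -> : u `^ e = u `^ k0 * (u `^ (k0 + 1)) `^ k0.
    by rewrite -powRrM -powRD// (gt_eqF u0) implybT.
  rewrite [leRHS]mulrCA ler_pM2l// -powRM ?powR_ge0//; last first.
    by rewrite mulr_ge0// ltW.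
  apply: ge0_ler_powR; rewrite ?nnegrE//; first exact: ltW.
    by rewrite addr_ge0// ltW.
  by rewrite !mulr_ge0 ?powR_ge0// ltW.
have rat' : (2 * d.+1%:R * (s' * rho x / r)) ^+ d <= D * u `^ (e * d%:R).
  rewrite powRrM powR_mulrn ?powR_ge0// -exprMn lerXn2r ?nnegrE//.
  - by rewrite mulr_ge0// divr_ge0// ltW.
  - rewrite mulr_ge0 ?powR_ge0// mulr_ge0// mulr_ge0 ?powR_ge0// mulr_ge0// ?mulr_ge0//; exact: ltW.
  - by rewrite -[leRHS]mulrA ler_pM2l.
have expr' : expR (c2 * r') <= expR (c2 * (2 * B0) * u `^ (k0 + 1)).
  by rewrite ler_expR -[leRHS]mulrA ler_pM2l.
apply: ler_pM_absorb expr' (HK u u1);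
  rewrite ?expR_ge0 ?(ltW v0) ?(ltW v'0) ?(ltW D0)//.
by apply: (le_trans vv'); rewrite ler_pM2r.
Qed.

End inclusions.

Theorem proposition3p2 (R : realType) (d : nat) (hd : (3 <= d)%N)
    (rho : 'rV[R]_d -> R) (k0 B0 : R) (hrho : critical_radius k0 B0 rho)
    (p : R) (hp : 1 < p) (c1 c2 c3 m1 m2 : R)
    (hc1 : 0 < c1) (hc2 : 0 < c2) (hc3 : 0 < c3)
    (hm1 : 0 < m1) (hm1k0 : m1 < (k0 + 1)^-1) (hm2 : k0 + 1 < m2) :
  [/\ Ap_infty rho p `<=` H_class rho p c1 m1,
      H_class rho p c1 m1 `<=` S_class rho p c2 &
      S_class rho p c2 `<=` H_class rho p c3 m2].
Proof.
split.
- exact: (Ap_infty_sub_H hrho).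
- exact: (H_sub_S hrho).
- exact: (S_sub_H hrho).
Qed.
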